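(* Let $G$ be a non-trivial finite totally $2$-closed group whose Fitting subgroup is trivial. Then $G=T_1\times\cdots\times T_r$ for some $r\ge 1$, where for each $i\le r$, $T_i$ is a finite nonabelian simple group which is totally $2$-closed, and $T_i$ is not a section of $\prod_{j\neq i}T_j$.
   Context: For a permutation group $G\le \mathrm{Sym}(\Omega)$, the $2$-closure $G^{(2),\Omega}$ is the group of all $g\in\mathrm{Sym}(\Omega)$ that leave invariant each $G$-orbit in the induced $G$-action on $\Omega\times\Omega$. A group $G$ is totally $2$-closed if $G^{(2),\Omega}=G$ whenever $G$ is faithfully represented as a permutation group on a set $\Omega$. A nontrivial group $X$ is a section of a group $G$ if there are subgroups $L\unlhd H\le G$ with $H/L\cong X$. The Fitting subgroup is the largest nilpotent normal subgroup. *)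

(* Defs.v *)
From HB Require Import structures.
From mathcomp Require Import all_boot all_fingroup all_solvable.

Set Implicit Arguments.
Unset Strict Implicit.
Unset Printing Implicit Defensive.

Local Open Scope group_scope.

(* The points [Omega] form an arbitrary type, so MathComp's [orbit],           *)
(* [faithful] and {perm _}, which need a finType, are not available here.      *)

Definition faithful_action (gT : finGroupType) (G : {group gT}) (Omega : Type)
    (to : action G Omega) : Prop :=
  forall a, a \in G -> (forall x, to x a = x) -> a = 1.

Definition orbital (gT : finGroupType) (G : {group gT}) (Omega : Type)
    (to : action G Omega) (x y : Omega) (p : Omega * Omega) : Prop :=
  exists2 a, a \in G & p = (to x a, to y a).

(* [f] is bijective, so the equivalence says that the image of each orbit      *)
(* under [f] is that orbit itself.                                             *)
Definition two_closure (gT : finGroupType) (G : {group gT}) (Omega : Type)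
    (to : action G Omega) (f : Omega -> Omega) : Prop :=
  bijective f /\
  forall (x y : Omega) (p : Omega * Omega),
    orbital to x y p <-> orbital to x y (f p.1, f p.2).

Definition totally_2closed (gT : finGroupType) (G : {group gT}) : Prop :=
  forall (Omega : Type) (to : action G Omega),
    faithful_action to ->
    forall f : Omega -> Omega,
      two_closure to f <-> exists2 a, a \in G & f =1 to^~ a.

Definition is_section (rT gT : finGroupType) (X : {group rT})
    (G : {group gT}) : Prop :=
  X :!=: 1 /\
  exists L H : {group gT}, [/\ L <| H, H \subset G & H / L \isog X].

(* Main.v *)
Require Import Defs.
From HB Require Import structures.
From mathcomp Require Import all_boot all_fingroup all_solvable.

Set Implicit Arguments.
Unset Strict Implicit.
Unset Printing Implicit Defensive.

Local Open Scope group_scope.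

(** Let [G] act on a disjoint union of [Omega1] and [Omega2].  A permutation of
    [Omega1] in the 2-closure of the first action, extended by the identity on
    [Omega2], lies in the 2-closure as soon as it preserves the orbits on
    [Omega1] of every point stabiliser of [Omega2].  Applied to the cosets of
    [A] and of [B] this shows that a factorisation [G = A * B] of a totally
    2-closed group, with cores meeting trivially, forces [G] to be the direct
    product of the two cores.  For a minimal normal subgroup [N] and a Sylow
    subgroup [P] of [N], the Frattini factorisation [G = N * 'N_G(P)] therefore
    makes [N] a direct factor, hence simple, and induction applies to its
    complement.  Finally, if [G = T \x M] and [phi : H -> T] is onto for some
    [H <= M], then every conjugate of the graph [D] of [phi] supplements [M],
    so that [t] in [T] acting on the cosets of [D] and trivially on those of [T]
    and [M] is in the 2-closure; this puts [t] in [D], and [t = 1]. *)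

(* The library versions of the next four lemmas ([act_inj], [actMin], [act1],
   [actKin]) are limited to actions on a finType. *)
Lemma actg_inj (gT : finGroupType) (D : {set gT}) (Omega : Type)
  (to : action D Omega) : left_injective to.
Proof. by case: to => ? []. Qed.

Lemma actgM (gT : finGroupType) (D : {set gT}) (Omega : Type)
  (to : action D Omega) x : {in D &, act_morph to x}.
Proof. by case: to => ? []. Qed.

Section Actions.

Variables (gT : finGroupType) (G : {group gT}).

Lemma actg1 (Omega : Type) (to : action G Omega) x : to x 1 = x.
Proof. by apply: (@actg_inj _ _ _ to 1); rewrite -actgM // mulg1. Qed.

Lemma actgK (Omega : Type) (to : action G Omega) x a :
  a \in G -> to (to x a) a^-1 = x.
Proof. by move=> Ga; rewrite -actgM ?groupV // mulgV actg1. Qed.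

Lemma two_closureP (Omega : Type) (to : action G Omega) (f : Omega -> Omega) :
  two_closure to f <->
  bijective f /\
  forall x y, exists a, [/\ a \in G, f x = to x a & f y = to y a].
Proof.
split=> [] [bijf f2]; split=> // x y.
  have [a Ga [-> ->]] : orbital to x y (f x, f y); last by exists a.
  by apply/(f2 x y (x, y)); exists 1; rewrite ?actg1.
case=> u v; have [a [Ga fu fv]] := f2 u v.
split=> [] [b Gb] /= [].
  move=> def_u def_v; exists (b * a); first exact: groupM.
  by rewrite fu fv def_u def_v !actgM.
rewrite fu fv => eq_u eq_v; exists (b * a^-1); first by rewrite groupM ?groupV.
by rewrite !(@actgM _ _ _ to) ?groupV // -eq_u -eq_v !actgK.
Qed.

Lemma two_closure_act (Omega : Type) (to : action G Omega) f a :
  a \in G -> f =1 to^~ a -> two_closure to f.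
Proof.
move=> Ga def_f; apply/two_closureP; split; last by move=> x y; exists a.
exists (to^~ a^-1) => x; rewrite def_f ?actgK //.
by rewrite -{2}[a]invgK actgK ?groupV.
Qed.

Section Sum.

Variables (Omega1 Omega2 : Type).
Variables (to1 : action G Omega1) (to2 : action G Omega2).

Definition sum_act (p : Omega1 + Omega2) a :=
  match p with inl x => inl (to1 x a) | inr y => inr (to2 y a) end.

Lemma sum_is_action : is_action G sum_act.
Proof.
split=> [a [x|y] [x'|y'] //= [] | [x|y] a b Ga Gb] /=; try by rewrite actgM.
  by move/(@actg_inj _ _ _ to1)->.
by move/(@actg_inj _ _ _ to2)->.
Qed.

Definition sum_action := Action sum_is_action.

Lemma totally_2closed_sum (f : Omega1 -> Omega1) :
    totally_2closed G ->
    (forall a, a \in G -> (forall x, to1 x a = x) -> (forall y, to2 y a = y) ->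
       a = 1) ->
    two_closure to1 f ->
    (forall x y, exists a, [/\ a \in G, f x = to1 x a & to2 y a = y]) ->
  exists a, [/\ a \in G, f =1 to1^~ a & forall y, to2 y a = y].
Proof.
move=> G2c ffulG /two_closureP[[g fK gK] f2] f_stab.
pose h (p : Omega1 + Omega2) := match p with inl x => inl (f x) | inr _ => p end.
have ffulU: faithful_action sum_action.
  move=> a Ga fix_a; apply: ffulG => // [x | y].
    by case: (fix_a (inl x)).
  by case: (fix_a (inr y)).
have [|a Ga def_h] := (G2c _ _ ffulU h).1.
  apply/two_closureP; split.
    exists (fun p => match p with inl x => inl (g x) | inr _ => p end).
      by case=> //= x; rewrite fK.
    by case=> //= x; rewrite gK.
  case=> [x|y] [x'|y'] /=.
  - by have [a [Ga -> ->]] := f2 x x'; exists a.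
  - by have [a [Ga -> fy]] := f_stab x y'; exists a; rewrite fy.
  - by have [a [Ga -> fy]] := f_stab x' y; exists a; rewrite fy.
  by exists 1; rewrite !actg1.
exists a; split=> // [x | y].
  by case: (def_h (inl x)).
by case: (def_h (inr y)).
Qed.

End Sum.

Section Pullback.

Variables (hT : finGroupType) (D : {set hT}) (Omega : Type).
Variables (to : action D Omega) (phi : gT -> hT).
Hypotheses (phiM : {in G &, {morph phi : a b / a * b}})
           (phiD : {in G, forall a, phi a \in D}).

Lemma pullback_is_action : is_action G (fun x a => to x (phi a)).
Proof.
split=> [a x y /(@actg_inj _ _ _ to) // | x a b Ga Gb].
by rewrite phiM // actgM ?phiD.
Qed.

Definition pullback_action := Action pullback_is_action.

End Pullback.

Section Cosets.

Variable A : {group gT}.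

Let sG_dom : G \subset subact_dom (fun X => X \in rcosets A G) 'Rs.
Proof.
rewrite /subact_dom; suff ->: [set X | X \in rcosets A G] = rcosets A G.
  exact: actsRs_rcosets.
by apply/setP=> X; rewrite inE.
Qed.

Definition rcosets_action : action G {X | X \in rcosets A G} :=
  ('Rs^? \ sG_dom)%act.

Lemma val_rcosets_action u a :
  a \in G -> val (rcosets_action u a) = val u :* a.
Proof. by move=> Ga; rewrite [LHS]val_subact (subsetP sG_dom) -?rcosetE. Qed.

Lemma rcosets_action_fixP a :
  a \in G -> (forall u, rcosets_action u a = u) <-> a \in gcore A G.
Proof.
move=> Ga; split=> [fix_a | /bigcapP core_a u].
  apply/bigcapP=> x Gx.
  have Ax: A :* x \in rcosets A G by apply/rcosetsP; exists x.
  have /(congr1 val) := fix_a (Sub (A :* x) Ax).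
  rewrite val_rcosets_action //= -rcosetM => /rcoset_eqP.
  by rewrite mem_rcoset mem_conjg conjgE invgK mulgA.
apply: val_inj; rewrite val_rcosets_action //.
have /rcosetsP[x Gx ->] := valP u; rewrite -rcosetM; apply/rcoset_eqP.
by rewrite mem_rcoset -mulgA; have:= core_a x Gx; rewrite mem_conjg conjgE invgK.
Qed.

(* The hypothesis on [t] says that [t] preserves the orbits of the stabiliser
   of [y] on the cosets of [A]. *)
Lemma totally_2closed_rcosets (Omega : Type) (to : action G Omega) t :
    totally_2closed G ->
    (forall a, a \in gcore A G -> a \in G -> (forall y, to y a = y) -> a = 1) ->
    t \in G ->
    (forall x y, x \in G ->
       exists2 a, a \in G /\ to y a = y & t * a^-1 \in A :^ x) ->
  exists2 a, a \in G /\ (forall y, to y a = y) & t * a^-1 \in gcore A G.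
Proof.
move=> G2c ffulG Gt t_stab.
have [||u y|a [Ga def_t fix_a]] :=
  @totally_2closed_sum _ _ rcosets_action to (rcosets_action^~ t) G2c.
- by move=> a Ga /(rcosets_action_fixP Ga).1; move/ffulG; apply.
- exact: two_closure_act Gt _.
- have /rcosetsP[x Gx def_u] := valP u.
  have [a [Ga fix_a]] := t_stab x y Gx.
  rewrite mem_conjg conjgE invgK => At; exists a; split=> //.
  apply: val_inj; rewrite !val_rcosets_action // def_u -!rcosetM.
  by apply/rcoset_eqP; rewrite mem_rcoset invMg -!mulgA in At *.
exists a => //; apply/rcosets_action_fixP; first by rewrite groupM ?groupV.
by move=> u; rewrite actgM ?groupV // def_t actgK.
Qed.

End Cosets.

End Actions.

Section TotallyTwoClosed.

Variable gT : finGroupType.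
Implicit Types A G H K M N T : {group gT}.

Lemma dprod_remgr G H K : H \x K = G ->
  [/\ {in G &, {morph remgr K H : a b / a * b}},
      {in G, forall a, remgr K H a \in H},
      {in H, remgr K H =1 id}
    & {in K, forall a, remgr K H a = 1}].
Proof.
move/dprodWsdC=> defG; have [nsKG _ mulKH _ tiKH] := sdprod_context defG.
split=> [|a Ga|a Ha|a Ka].
- by apply: remgrM nsKG; apply/complP.
- by rewrite mem_remgr ?mulKH.
- exact: remgr_id.
exact: remgr1.
Qed.

Lemma dprod_remgr_eq1 G H K a : H \x K = G ->
  a \in G -> remgr K H a = 1 -> a \in K.
Proof.
move/dprodWsdC=> /sdprodP[_ mulKH _ _]; rewrite -mulKH => KHa.
by rewrite {2}(divgr_eq K H a) => ->; rewrite mulg1 mem_divgr.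
Qed.

Lemma totally_2closed_dprod G H K :
  H \x K = G -> totally_2closed G -> totally_2closed H.
Proof.
move=> defG G2c Omega to ffulH f; split; last first.
  by case=> a Ha /(two_closure_act Ha).
move=> f2c; have [rHM rHG rHid rH1] := dprod_remgr defG.
have defG' : K \x H = G by rewrite dprodC.
have [rKM rKG rKid rK1] := dprod_remgr defG'.
have sHG: H \subset G by have/dprodP[_ <- _ _] := defG; apply: mulG_subl.
pose to1 := pullback_action to rHM rHG.
pose to2 := pullback_action 'R rKM (fun a _ => in_setT _).
have [bij_f f2] := (two_closureP _ _).1 f2c.
have [a Ga fix1 fix2 | | x y | a [Ga def_f fix_a]] :=
  @totally_2closed_sum _ _ _ _ to1 to2 f G2c.
- have Ha: a \in H.
    apply: dprod_remgr_eq1 defG' Ga _; have:= fix2 1; rewrite /= mul1g; exact.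
  by apply: ffulH => // x; have:= fix1 x; rewrite /= rHid.
- apply/two_closureP; split=> // x y.
  have [a [Ha fx fy]] := f2 x y; exists a.
  by rewrite (subsetP sHG) //= rHid.
- have [a [Ha fx _]] := f2 x x; exists a.
  by rewrite (subsetP sHG) //= rHid // rK1 // mulg1.
by exists (remgr K H a); rewrite ?rHG.
Qed.

Lemma totally_2closed_supplement G A N :
    totally_2closed G -> N <| G -> A * N = G -> gcore A G :&: N = 1 ->
  N \x gcore A G = G.
Proof.
move=> G2c nsNG mulAN tiAN; have [sNG nNG] := andP nsNG.
have sAG: A \subset G by rewrite -mulAN mulG_subl.
have nsCG := gcore_normal sAG.
pose to := pullback_action 'R (sub_in2 (subsetP nNG) (morphM (coset_morphism N)))
  (fun a _ => in_setT _).
have fix_to a y : a \in G -> (to y a = y) <-> a \in N.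
  move=> Ga; split=> /= [|Na]; last by rewrite coset_id ?mulg1.
  rewrite -[RHS]mulg1 => /mulgI; apply: coset_idr; exact: (subsetP nNG).
suff mulNC : N * gcore A G = G.
  rewrite dprodE // 1?setIC //; apply/commG1P/trivgP.
  rewrite -tiAN subsetI commg_subl commg_subr.
  rewrite (subset_trans sNG (normal_norm nsCG)).
  exact: subset_trans (normal_sub nsCG) nNG.
apply/eqP; rewrite eqEsubset mul_subG ?(normal_sub nsCG) //=.
rewrite normC ?(subset_trans sNG (normal_norm nsCG)) //.
apply/subsetP=> t Gt.
have [a Ca Ga fix_a | x y Gx | a [Ga fix_a] Cta] :=
  @totally_2closed_rcosets _ G A _ to t G2c _ Gt.
- apply/set1gP; rewrite -tiAN inE Ca; exact/(fix_to a 1 Ga)/fix_a.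
- have: t \in A :^ x * N.
    by rewrite -(normsP nNG x Gx) -conjsMg mulAN conjGid.
  case/mulsgP=> c a Ac Na def_t; have Ga := subsetP sNG a Na.
  by exists a; rewrite ?def_t ?mulgK //; split=> //; apply/fix_to.
rewrite -(mulgKV a t) mem_mulg //; exact/(fix_to a 1 Ga)/fix_a.
Qed.

Lemma minnormal_dprod G N :
    totally_2closed G -> 'F(G) = 1 -> minnormal N G -> N \subset G ->
  exists K, N \x K = G.
Proof.
move=> G2c F1 minN sNG; have [/andP[ntN nNG] minN_G] := mingroupP minN.
have nsNG: N <| G by apply/andP.
have [p p_pr pN] : exists2 p, prime p & p %| #|N|.
  by exists (pdiv #|N|); rewrite ?pdiv_dvd // pdiv_prime // cardG_gt1.
have [P sylP] := Sylow_exists p N.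
exists [group of gcore 'N_G(P) G]; apply: totally_2closed_supplement => //.
  by rewrite normC ?(Frattini_arg nsNG sylP) // subIset ?nNG.
apply/eqP/idPn => ntCN.
have nCN: G \subset 'N(gcore 'N_G(P) G :&: N) by rewrite normsI ?gcore_norm.
have sNC : N \subset gcore 'N_G(P) G.
  by rewrite -(minN_G [group of gcore 'N_G(P) G :&: N]) ?ntCN ?subsetIl ?subsetIr.
have nPN : N \subset 'N(P).
  by apply: subset_trans sNC (subset_trans (gcore_sub _ _) (subsetIr _ _)).
have nsPN : P <| N by rewrite /normal (pHall_sub sylP).
have: P \subset 'F(G).
  apply: Fitting_max (pgroup_nil (pHall_pgroup sylP)).
  apply: char_normal_trans nsNG.
  by rewrite -(normal_Hall_pcore sylP nsPN) pcore_char.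
rewrite F1 => /trivgP P1; have /eqP := card_Hall sylP.
by rewrite P1 cards1 eq_sym p_part_eq1 mem_primes p_pr cardG_gt0 pN.
Qed.

Lemma dprod_simple G N K : minnormal N G -> N \x K = G -> simple N.
Proof.
move=> /mingroupP[/andP[ntN nNG] minN] /dprodP[_ defG cNK _].
apply/simpleP; split=> // H /andP[sHN nHN].
have [-> | ntH] := eqsVneq H 1; [by left | right].
apply: minN => //; rewrite ntH -defG mul_subG //.
by apply: cents_norm; apply: subset_trans cNK (centS sHN).
Qed.

Lemma totally_2closed_simple_dprod G :
    totally_2closed G -> 'F(G) = 1 ->
  exists2 s : seq {group gT},
    \big[dprod/1]_(T <- s) T = G
  & all (fun T : {group gT} => simple T && ~~ abelian T) s.
Proof.
have [n] := ubnP #|G|; elim: n G => // n IHn G leGn G2c F1.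
have [G1 | ntG] := eqsVneq G 1; first by exists [::]; rewrite ?big_nil ?G1.
have [N minN sNG] := minnormal_exists ntG (normG G).
have [K defG] := minnormal_dprod G2c F1 minN sNG.
have simN := dprod_simple minN defG.
have [ntN nNG] := andP (mingroupp minN).
have nsNG: N <| G by apply/andP.
have nabN: ~~ abelian N.
  apply: contra ntN => abN; rewrite -subG1 -F1.
  exact: Fitting_max nsNG (abelian_nil abN).
have nsKG: K <| G.
  by have [] := sdprod_context (dprodWsdC defG).
have [|||s defK simS] := IHn K.
- apply: leq_trans (leGn : #|G| <= n).
  by rewrite -(dprod_card defG) ltn_Pmull ?cardG_gt0 ?cardG_gt1.
- by apply: (@totally_2closed_dprod G K N) G2c; rewrite dprodC.
- apply/trivgP; rewrite -F1 Fitting_max ?Fitting_nil //.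
  exact: char_normal_trans (Fitting_char K) nsKG.
exists (N :: s); first by rewrite big_cons defK.
by rewrite /= simN nabN.
Qed.

Lemma totally_2closed_not_section G T M :
  totally_2closed G -> T \x M = G -> ~ is_section T M.
Proof.
move=> G2c defG [ntT [L [H [nsLH sHM /isogP[f injf fHL]]]]].
have defG' : M \x T = G by rewrite dprodC.
have [/dprodP[_ mulTM cTM tiTM] nLH] := (defG, normal_norm nsLH).
have [rTM rTG rTid rT1] := dprod_remgr defG.
have [rMM rMG rMid rM1] := dprod_remgr defG'.
have [sTG sMG] : T \subset G /\ M \subset G.
  by rewrite -mulTM mulG_subl mulG_subr.
pose phi h := f (coset L h).
have HLq h : h \in H -> coset L h \in H / L by move=> Hh; apply: mem_quotient.
have phiT h : h \in H -> phi h \in T.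
  by move=> Hh; rewrite -fHL mem_morphim ?HLq.
have graphM : {in H &, {morph (fun h => phi h * h) : h k / h * k}}.
  move=> h k Hh Hk; have nLh := subsetP nLH.
  rewrite /phi morphM ?nLh //= morphM ?HLq // -!mulgA; congr (_ * _).
  rewrite !mulgA; congr (_ * _).
  by rewrite (centsP cTM _ (subsetP sHM _ Hh) _ (phiT _ Hk)).
pose D := [group of Morphism graphM @* H].
have DP d : reflect (exists2 h, h \in H & d = phi h * h) (d \in D).
  apply: (iffP morphimP) => [[h _ Hh ->] | [h Hh ->]]; first by exists h.
  by exists h.
have nMG : G \subset 'N(M).
  by have [/andP[]] := sdprod_context (dprodWsdC defG).
have sGDM : G \subset D * M.
  rewrite -mulTM; apply/subsetP=> _ /mulsgP[t m Tt Mm ->].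
  have /morphimP[_ _ /morphimP[h _ Hh ->] ->] : t \in f @* (H / L) by rewrite fHL.
  apply/mulsgP; exists (phi h * h) (h^-1 * m); first by apply/DP; exists h.
    by rewrite groupM // groupV (subsetP sHM).
  by rewrite mulgA mulgK.
pose toT := pullback_action 'R rTM (fun a _ => in_setT _).
pose toM := pullback_action 'R rMM (fun a _ => in_setT _).
case/trivgPn: ntT => t Tt /eqP[].
have Gt := subsetP sTG t Tt.
have faithTM a : a \in G -> (forall y, sum_action toT toM y a = y) -> a = 1.
  move=> Ga fix_a; apply/set1gP; rewrite -tiTM inE.
  rewrite (dprod_remgr_eq1 defG') ?(dprod_remgr_eq1 defG) //.
    by have [] := fix_a (inl 1); rewrite mul1g.
  by have [] := fix_a (inr 1); rewrite mul1g.
have [a _ Ga | x y Gx | a [Ga /(faithTM a Ga)->]] :=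
  @totally_2closed_rcosets _ G D _ (sum_action toT toM) t G2c _ Gt.
- exact: faithTM.
- case: y => y /=.
    have: t \in D :^ x * M.
      rewrite -(normsP nMG x Gx) -conjsMg; apply: subsetP Gt.
      by rewrite -{1}(conjGid Gx) conjSg.
    case/mulsgP=> d m Dd Mm def_t; exists m; last by rewrite def_t mulgK.
    by rewrite (subsetP sMG) // rT1 // mulg1.
  by exists t; rewrite ?mulgV ?group1 // rM1 // mulg1.
rewrite invg1 mulg1 => /(subsetP (gcore_sub _ _))/DP[h Hh def_t].
have Th : h \in T by rewrite -(groupMl _ (phiT h Hh)) -def_t.
have h1 : h = 1.
  by apply/set1gP; rewrite -tiTM inE Th (subsetP sHM).
by rewrite def_t h1 /phi !morph1 mulg1.
Qed.

End TotallyTwoClosed.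

Theorem theorem2p5 (gT : finGroupType) (G : {group gT})
    (ntG : G :!=: 1) (G2c : totally_2closed G) (F1 : 'F(G) = 1) :
  exists (r : nat) (T : 'I_r -> {group gT}),
    [/\ 0 < r,
        \big[dprod/1]_(i < r) T i = G &
        forall i : 'I_r,
          [/\ simple (T i), ~~ abelian (T i), totally_2closed (T i) &
              ~ is_section (T i) (\prod_(j < r | j != i) T j)%G]].
Proof.
have [s defG simS] := totally_2closed_simple_dprod G2c F1.
pose T (i : 'I_(size s)) := nth 1%G s i.
have defT : \big[dprod/1]_(i < size s) T i = G.
  by rewrite -defG (big_nth 1%G) big_mkord.
exists (size s), T; split=> // [|i].
  case: s defG {T defT simS} => // /esym.
  by rewrite big_nil => /eqP; rewrite (negPf ntG).
have /andP[simT nabT] : simple (T i) && ~~ abelian (T i).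
  by apply: (allP simS); apply: mem_nth.
have defG_i : T i \x (\prod_(j < size s | j != i) T j)%G = G.
  have:= defT; rewrite (bigD1 i) //= => defTi.
  have [[_ M _ defM] _ _ _] := dprodP defTi.
  by rewrite bigprodGE (bigdprodWY defM) -defM.
split=> //; first exact: totally_2closed_dprod defG_i G2c.
exact: totally_2closed_not_section defG_i.
Qed.
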